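(* Let $\mathbb{K}=\mathbb{R}$ or $\mathbb{C}$. Any ($8$-dimensional, $2$-step nilpotent) symplectic Lie algebra over $\mathbb{K}$ with characteristic sequence $(2,2,1,1,1,1)$ is decomposable.
   Context: For a finite-dimensional Lie algebra $\mathfrak{g}$ over $\mathbb{K}$ and a skew-symmetric bilinear form $\theta$ on $\mathfrak{g}$, $d\theta(X,Y,Z)=\theta([X,Y],Z)+\theta([Y,Z],X)+\theta([Z,X],Y)$. A Lie algebra of dimension $2p$ is called symplectic if it admits a skew-symmetric bilinear form $\theta$ with $d\theta=0$ and $\theta^p\neq 0$ (nondegenerate). The lower central series is $C^0(\mathfrak{g})=\mathfrak{g}$, $C^j(\mathfrak{g})=[\mathfrak{g},C^{j-1}(\mathfrak{g})]$; $\mathfrak{g}$ is $2$-step nilpotent if $C^2(\mathfrak{g})=0$ and $C^1(\mathfrak{g})\neq 0$. For $X\in\mathfrak{g}$, $X\ne 0$, in a nilpotent Lie algebra, $c(X)$ denotes the decreasing sequence of the sizes of the Jordan blocks of the nilpotent operator $\mathrm{ad}(X)$; the characteristic sequence of $\mathfrak{g}$ is $c(\mathfrak{g})=\max\{c(X): X\in\mathfrak{g}\setminus C^1(\mathfrak{g})\}$ for the lexicographic order. A Lie algebra is decomposable if it is the direct product (direct sum) of two nonzero ideals. *)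

(* Defs.v *)
From HB Require Import structures.
From mathcomp Require Import all_boot all_order all_algebra.
From mathcomp Require Import reals.
From mathcomp Require Import complex.

Set Implicit Arguments.
Unset Strict Implicit.
Unset Printing Implicit Defensive.

Import Order.TTheory GRing.Theory Num.Theory.
Local Open Scope ring_scope.

HB.mixin Record isLieAlgebra (K : fieldType) L of Vector K L := {
  lie : {bilinear L -> L -> L};
  liexx : forall x : L, lie x x = 0;
  lie_jacobi : forall x y z : L,
    lie x (lie y z) + lie y (lie z x) + lie z (lie x y) = 0
}.

#[short(type="lieAlgType")]
HB.structure Definition LieAlgebra (K : fieldType) :=
  {L of isLieAlgebra K L & Vector K L}.

Section LieAlgebraDefs.
Variables (K : fieldType) (g : lieAlgType K).
Implicit Types (x y z : g) (U V W I J : {vspace g}) (s t : seq nat).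

Definition ad x : 'End(g) := linfun (lie x).

Definition lie_span U V : {vspace g} :=
  <<[seq lie u v | u <- vbasis U, v <- vbasis V]>>%VS.

(* The definition of [lie_span] on bases does not depend on the bases: it is
   the smallest subspace containing all brackets. *)
Lemma lie_spanP U V W :
  reflect (forall u v, u \in U -> v \in V -> lie u v \in W)
          (lie_span U V <= W)%VS.
Proof.
apply: (iffP span_subvP) => [UVW u v Uu Vv | UVW _ /allpairsP[[u v] /= [Uu Vv ->]]].
  rewrite (coord_vbasis Uu) (coord_vbasis Vv) linear_sumlz memv_suml // => i _.
  rewrite linear_sumr memv_suml // => j _.
  rewrite linearZl_LR linearZr_LR !memvZ //=; apply: UVW.
  by apply/allpairsP; exists ((vbasis U)`_i, (vbasis V)`_j); rewrite !mem_nth ?size_tuple.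
by apply: UVW; apply: vbasis_mem.
Qed.

Fixpoint lower_central (j : nat) : {vspace g} :=
  if j is i.+1 then lie_span fullv (lower_central i) else fullv.

Definition two_step_nilpotent : Prop :=
  lower_central 2 = 0%VS /\ lower_central 1 <> 0%VS.

Definition lie_ideal I : Prop := forall x y, y \in I -> lie x y \in I.

Definition decomposable : Prop :=
  exists I J : {vspace g},
    [/\ lie_ideal I, lie_ideal J, I <> 0%VS & J <> 0%VS] /\
    ((I + J)%VS = fullv /\ (I :&: J)%VS = 0%VS).

Definition closed_form (theta : g -> g -> K) : Prop := forall x y z,
  theta (lie x y) z + theta (lie y z) x + theta (lie z x) y = 0.

Definition symplectic : Prop :=
  ~~ odd (\dim {:g}) /\
  exists theta : {skew_symmetric g}, closed_form theta /\ nondegenerate theta.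

Definition nilp_jordan_block (n : nat) : 'M[K]_n :=
  \matrix_(i, j) (j == i.+1 :> nat)%:R.

(* [f] has, in some basis, a block diagonal matrix whose blocks are nilpotent
   Jordan blocks of (positive) sizes listed by the decreasing sequence [s].
   Rows are the images of the basis vectors, as for [mxof]. *)
Definition jordan_type (f : 'End(g)) s : Prop :=
  [/\ sorted geq s, 0%N \notin s &
   exists2 b : (\sum_(i < size s) nth 0 s i)%N.-tuple g, basis_of fullv b &
   forall k : 'I__, f b`_k = \sum_l
     (\mxdiag_(i < size s) nilp_jordan_block (nth 0%N s i)) k l *: b`_l].

(* [s] is the maximum of the c(x), x outside C^1(g), where c(x) = s means
   [jordan_type (ad x) s]. *)
Definition characteristic_sequence s : Prop :=
  (exists2 x, x \notin lower_central 1 & jordan_type (ad x) s) /\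
  (forall x t, x \notin lower_central 1 -> jordan_type (ad x) t ->
    ((t : seqlexi nat) <= s)%O).

End LieAlgebraDefs.

Arguments two_step_nilpotent {K} g.
Arguments decomposable {K} g.
Arguments symplectic {K} g.
Arguments characteristic_sequence {K} g s.

(* Main.v *)
Require Import Defs.
From mathcomp Require Import all_boot all_order all_algebra.
From mathcomp Require Import reals complex.
From mathcomp Require Import zify.

(** Let [C = [g, g]], which is central because [g] is 2-step nilpotent.  It is
    enough to produce a central element outside [C]: its line is an ideal, and
    any complement of that line that contains [C] is an ideal too
    ([central_decomposable]).

    The characteristic sequence enters only through ranks.  As [ad x] squares
    to zero, its Jordan type lists one 2 for each unit of rank, so the maximum
    (2, 2, 1, 1, 1, 1) means that all [ad x] have rank at most 2 and that some
    [ad x] has rank exactly 2 ([characteristic_sequence_rank]).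

    If [\dim C <= 2], the symplectic form [theta] gives the central element
    ([symplectic_central]).  The orthogonal [H] of [C] is abelian, since
    [theta [h, k] v] is, by closedness, a sum of terms pairing [h] or [k] with
    [C].  It has codimension at most 2, say [g = H + <p, q>], so [u] in [H] is
    central as soon as it commutes with [p] and [q].  As [H] is orthogonal to
    [C], this amounts to the vanishing of the four numbers [theta [p, u] p],
    [theta [p, u] q], [theta [q, u] p] and [theta [q, u] q]; closedness makes
    the second and the third equal.  So the centre contains the common kernel
    of 2 + 3 linear forms, of dimension at least 8 - 5 = 3 > [\dim C].

    If [\dim C >= 3], the bound on the ranks is enough ([rank_two_central]).
    When [ad x] has maximal rank, perturbing it in the direction [ad w] shows
    that [ad w] maps the kernel of [ad x] into the image of [ad x]
    ([perturbation_rank]).  Take [ad x] of rank 2, with image spanned by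
    [a = [x, y]] and [b = [x, z]]; then [C] is spanned by [a], [b] and
    [c = [y, z]], which are therefore linearly independent.  Now [x], [y] and
    [z] all have maximal rank, with images the three planes [<a, b>], [<a, c>]
    and [<b, c>].  An element that commutes with [x], [y] and [z] has all its
    brackets in the intersection of these planes, which is 0.  Every element
    of [g] is congruent to such an element modulo [<x, y, z>], so the centre
    has codimension at most 3: it cannot lie in [C], as 3 + 3 < 8. *)

Set Implicit Arguments.
Unset Strict Implicit.
Unset Printing Implicit Defensive.

Import Order.TTheory GRing.Theory Num.Theory.
Local Open Scope ring_scope.

(** * Linear algebra *)

Section LinearAlgebra.
Variable K : fieldType.

Lemma leq_dim_bigcap_lker (V : vectType K) (s : seq 'Hom(V, K^o)) :
  (\dim {:V} <= \dim (\bigcap_(phi <- s) lker phi)%VS + size s)%N.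
Proof.
elim: s => [|phi s IHs]; first by rewrite big_nil addn0.
rewrite big_cons capvC /= addnS -addSn (leq_trans IHs) // leq_add2r.
rewrite -(limg_ker_dim phi (\bigcap_(i <- s) lker i)) -addn1 leq_add2l.
by rewrite (leq_trans (dimvS (subvf _))) // dimvf.
Qed.

(** The two generators are allowed to be dependent or zero, so that the bound
    on the dimension need not be an equality. *)
Lemma span_pair (V : vectType K) (U : {vspace V}) :
  (\dim U <= 2)%N -> exists p q, U = <<[:: p; q]>>%VS.
Proof.
move=> dimU; exists (vbasis U)`_0, (vbasis U)`_1.
have memU i : (vbasis U)`_i \in U.
  have [lt_i | le_i] := ltnP i (size (vbasis U)).
    by rewrite vbasis_mem // mem_nth.
  by rewrite nth_default // mem0v.
apply/eqP; rewrite eqEsubv andbC; apply/andP; split.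
  by apply/span_subvP => v; rewrite !inE => /orP[] /eqP ->.
rewrite -{1}(span_basis (vbasisP U)); apply/span_subvP => v.
case/(nthP 0) => i; rewrite size_tuple => lti <-.
have: (i < 2)%N by apply: leq_trans dimU.
case: i lti => [|[|]] // _ _.
  by rewrite memv_span ?inE ?eqxx.
by rewrite memv_span ?inE ?eqxx ?orbT.
Qed.

Lemma mem_span_pair (V : vectType K) (p q v : V) :
  v \in <<[:: p; q]>>%VS -> exists a b, v = a *: p + b *: q.
Proof.
rewrite span_cons span_seq1 => /memv_addP[_ /vlineP[a ->] [_ /vlineP[b ->] ->]].
by exists a, b.
Qed.
End LinearAlgebra.

Section Perturbation.
Variable K : numFieldType.

(** The matrix of the perturbed family in the coordinates of [X] is
    [1 + t B]; its determinant is a polynomial in [t] with value 1 at 0, so it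
    does not vanish at all nonzero [t]. *)
Lemma free_perturbation (V : vectType K) n (X Y : n.-tuple V) :
  free X ->
  exists2 t : K, t != 0 & free [tuple X`_i + t *: Y`_i | i < n].
Proof.
move=> freeX.
pose B : 'M[K]_n := \matrix_(i, j) coord X j Y`_i.
pose p : {poly K} := \det (1%:M + 'X *: map_mx polyC B).
have pE t : p.[t] = \det (1%:M + t *: B).
  rewrite -horner_evalE -det_map_mx; congr (\det _); apply/matrixP => i j.
  by rewrite !mxE /= /horner_eval hornerD hornerMn !hornerE.
have p_neq0 : p != 0.
  apply/eqP => p0; move: (pE 0); rewrite p0 horner0 scale0r addr0 det1.
  by move/eqP; rewrite eq_sym oner_eq0.
have [t t_neq0 pt_neq0] : exists2 t, t != 0 & ~~ root p t.
  (* More candidates than the degree of [p] allows roots. *)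
  pose rs : seq K := [seq k.+1%:R | k <- iota 0 (size p)].
  have /allPn[t /mapP[k _ ->] pk] : ~~ all (root p) rs.
    apply/negP => /(max_poly_roots p_neq0); rewrite size_map size_iota ltnn.
    rewrite map_inj_uniq ?iota_uniq; first by move/(_ isT).
    by move=> i j /eqP; rewrite eqr_nat => /eqP[].
  by exists k.+1%:R => //; rewrite pnatr_eq0.
exists t => //; apply/freeP => k kX0.
have: (\row_i k i) *m (1%:M + t *: B) = 0.
  apply/rowP => j; rewrite !mxE -[RHS](linear0 (coord X j)) -[in RHS]kX0.
  rewrite linear_sum; apply: eq_bigr => i _.
  by rewrite -tnth_nth tnth_mktuple linearZ linearD linearZ /= coord_free // !mxE.
move/(congr1 (mulmx^~ (invmx (1%:M + t *: B)))).
rewrite mul0mx mulmxK; last by rewrite unitmxE unitfE -pE.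
by move/rowP => k0 i; move: (k0 i); rewrite !mxE.
Qed.

(** If [g u] were not in the image of [f], it would complete a basis
    [f e_1, ..., f e_m] of that image to a free family.  For a suitable
    [t != 0], the vectors [(f + t g) e_i = f e_i + t (g e_i)] together with
    [g u = (f + t g) (t^-1 u)] would still be free, so that [f + t g] would
    have rank greater than [m]. *)
Lemma perturbation_rank (U V : vectType K) (f g : 'Hom(U, V)) :
  (forall t, \dim (limg (f + t *: g)%R) <= \dim (limg f))%N ->
  forall u, u \in lker f -> g u \in limg f.
Proof.
move=> rank_max u; rewrite memv_ker => /eqP fu0; apply: contraT => gu_notin.
pose X := [tuple of g u :: vbasis (limg f)].
pose Y := [tuple of 0 :: [seq g (f^-1%VF v) | v <- vbasis (limg f)]].
have [|t t_neq0] := @free_perturbation _ _ X Y.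
  rewrite free_cons (span_basis (vbasisP _)) gu_notin.
  exact: basis_free (vbasisP _).
set Z := mktuple _; move=> freeZ.
have: (<<Z>> <= limg (f + t *: g)%R)%VS.
  apply/span_subvP => _ /mapP[i _ ->]; case: (unliftP ord0 i) => [j|] -> /=.
    have jP : (j < size (vbasis (limg f)))%N by rewrite size_tuple.
    rewrite (nth_map 0) //; set v := _`_j.
    suff -> : v + t *: g (f^-1%VF v) = (f + t *: g) (f^-1%VF v).
      by rewrite memv_img ?memvf.
    by rewrite !lfun_simp limg_lfunVK // vbasis_mem // mem_nth.
  rewrite scaler0 addr0.
  suff -> : g u = (f + t *: g) (t^-1 *: u) by rewrite memv_img ?memvf.
  by rewrite !lfun_simp !linearZ /= fu0 scaler0 add0r scalerA mulVf // scale1r.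
move/dimvS => /leq_trans/(_ (rank_max t)).
by rewrite (eqnP freeZ) size_tuple ltnn.
Qed.
End Perturbation.

(** * Jordan types of square-zero endomorphisms *)

Section Jordan.
Variable K : fieldType.

(** The row of index [(i, j)] of a block diagonal Jordan matrix sends the
    [j]-th basis vector of block [i] to the next vector of the same block, or
    to 0 when there is none; the option returned by [insub] tells these cases
    apart. *)
Lemma sum_mxdiag_jordan (V : lmodType K) m (p : 'I_m -> nat)
    (v : 'I_(\sum_i p i) -> V) i (j : 'I_(p i)) :
  \sum_l (\mxdiag_i nilp_jordan_block K (p i)) (tagnat.Rank i j) l *: v l
    = oapp (v \o tagnat.Rank i) 0 (insub j.+1).
Proof.
have entryE a (c : 'I_(p a)) :
    (\mxdiag_i nilp_jordan_block K (p i)) (tagnat.Rank i j) (tagnat.Rank a c)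
      = ((i == a) && (c == j.+1 :> nat))%:R.
  set M := mxdiag _.
  have -> : M (tagnat.Rank i j) (tagnat.Rank a c) = submxblock M i a j c.
    by rewrite [RHS]mxE.
  rewrite mxblockK; case: eqP => [ia|_]; last by rewrite mxE.
  by move: c; rewrite -ia => c; rewrite conform_mx_id mxE.
case: insubP => [j' _ j'E | j_last] /=.
  rewrite (bigD1 (tagnat.Rank i j')) //= entryE j'E !eqxx scale1r.
  rewrite big1 ?addr0 // => l; rewrite -(tagnat.sig2K l) -val_eqE.
  rewrite tagnat.eq_Rank entryE j'E eq_sym => /negPf ->.
  by rewrite scale0r.
apply: big1 => l _; rewrite -(tagnat.sig2K l) entryE.
case: eqP => [il|]; last by rewrite scale0r.
case: eqP => [jl|]; last by rewrite scale0r.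
by case/negP: j_last; rewrite -jl il.
Qed.

Variable g : lieAlgType K.

(** The second vectors of the first two blocks are distinct basis vectors, and
    both are images under [f]. *)
Lemma jordan_type22_rank (f : 'End(g)) s :
  jordan_type f [:: 2, 2 & s]%N -> (1 < \dim (limg f))%N.
Proof.
case=> _ _ [b b_basis fb].
pose i0 : 'I_(size [:: 2, 2 & s]%N) := ord0.
pose i1 : 'I_(size [:: 2, 2 & s]%N) := lift ord0 ord0.
pose p (i : 'I_(size [:: 2, 2 & s]%N)) := nth 0%N [:: 2, 2 & s]%N i.
have fbE i (j j' : 'I_(p i)) : j' = j.+1 :> nat ->
    f b`_(tagnat.Rank (p_ := p) i j) = b`_(tagnat.Rank (p_ := p) i j').
  by move=> j'E; rewrite fb (sum_mxdiag_jordan (fun l => b`_l)) -j'E valK.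
have := fbE i0 (ord0 : 'I_2) (lift ord0 ord0 : 'I_2) erefl.
have := fbE i1 (ord0 : 'I_2) (lift ord0 ord0 : 'I_2) erefl.
set l1 := tagnat.Rank i1 (lift _ _).
set l0 := tagnat.Rank i0 (lift _ _) => fb1 fb0.
have b_free := basis_free b_basis.
have l01 : (l0 == l1) = false by rewrite -val_eqE tagnat.eq_Rank.
have free01 : free [:: b`_l0; b`_l1].
  rewrite free_cons span_seq1 seq1_free (free_not0 b_free); last first.
    by rewrite mem_nth ?size_tuple.
  rewrite andbT; apply/negP => /vlineP[c /(congr1 (coord b l0))].
  rewrite linearZ /= (coord_free l0 l0 b_free) (coord_free l1 l0 b_free).
  by rewrite eqxx eq_sym l01 mulr0 => /eqP; rewrite oner_eq0.
suff /dimvS: (<<[:: b`_l0; b`_l1]>> <= limg f)%VS by rewrite (eqnP free01).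
apply/span_subvP => v.
by rewrite !inE => /orP[] /eqP ->; rewrite -?fb0 -?fb1 memv_img ?memvf.
Qed.

(** A Jordan basis: each vector [x] of a basis of the image gives a block
    [f^-1 x, x] of size 2, and a basis of a complement [W] of the image in the
    kernel gives the blocks of size 1. *)
Lemma square_zero_jordan_type (f : 'End(g)) :
  (f \o f = 0)%VF ->
  exists m, jordan_type f (nseq (\dim (limg f)) 2 ++ nseq m 1)%N.
Proof.
move=> ff0; set r := \dim (limg f).
pose W := (lker f :\: limg f)%VS; exists (\dim W); set s := _ ++ _.
have Xmem i : (i < r)%N -> (vbasis (limg f))`_i \in limg f.
  by move=> lt_ir; rewrite vbasis_mem // mem_nth // size_tuple.
have Ymem i : (i < \dim W)%N -> (vbasis W)`_i \in W.
  by move=> lt_i; rewrite vbasis_mem // mem_nth // size_tuple.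
have im_ker : (limg f <= lker f)%VS.
  by rewrite lkerE -limg_comp ff0 lim0g.
have dim_g : (r + (r + \dim W) = \dim {:g})%N.
  rewrite -(limg_ker_dim f fullv) capfv -(dimv_cap_compl (lker f) (limg f)).
  by rewrite (capv_idPr im_ker) -/W -/r addnC.
have size_s : size s = (r + \dim W)%N by rewrite size_cat !size_nseq.
have nth_s i : (i < size s)%N -> nth 0%N s i = if (i < r)%N then 2%N else 1%N.
  rewrite size_s => lt_i; rewrite nth_cat size_nseq !nth_nseq.
  by case: ltnP => // le_ri; rewrite ltn_subLR // lt_i.
split.
- apply/(sortedP 0%N) => i lt_i; rewrite /geq /= !nth_s //; last exact: ltnW.
  case: (ltnP i.+1 r) => [lt_ir|_]; first by rewrite (ltnW lt_ir).
  by case: ifP.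
- by rewrite mem_cat !mem_nseq !andbF.
(* The [j]-th vector of the [i]-th block. *)
pose c i j := if (i < r)%N then
    (if j is 0%N then f^-1%VF (vbasis (limg f))`_i else (vbasis (limg f))`_i)
  else (vbasis W)`_(i - r).
pose p (i : 'I_(size s)) := nth 0%N s i.
pose b := [tuple c (tagnat.sig1 k) (tagnat.sig2 k) | k < (\sum_i p i)%N].
have bE i (j : 'I_(p i)) : b`_(tagnat.Rank i j) = c i j.
  by rewrite -tnth_nth tnth_mktuple tagnat.Rank2K /= tagnat.Rank1K.
exists b => [|k]; last first.
  rewrite -(tagnat.sig2K k) bE (sum_mxdiag_jordan (fun l => b`_l)).
  move: (tagnat.sig1 k) (tagnat.sig2 k) => {k} i j.
  have := ltn_ord j; rewrite [X in (_ < X)%N](nth_s _ (ltn_ord i)) /c.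
  have fX0 : (i < r)%N -> f (vbasis (limg f))`_i = 0.
    by move=> lt_ir; apply/eqP; rewrite -memv_ker (subvP im_ker) ?Xmem.
  have fY0 : ~~ (i < r)%N -> f (vbasis W)`_(i - r) = 0.
    rewrite -leqNgt => le_ri; apply/eqP; rewrite -memv_ker.
    by rewrite (subvP (diffvSl _ (limg f))) // Ymem // ltn_subLR // -size_s.
  case: insubP => [j' j'P j'E|] /=.
    rewrite bE /c j'E.
    have := ltn_ord j'; rewrite j'E [X in (_ < X)%N](nth_s _ (ltn_ord i)).
    case: ifP => [lt_ir|//]; case: (j : nat) => // _ _.
    by rewrite limg_lfunVK // Xmem.
  rewrite [X in (_ < X)%N](nth_s _ (ltn_ord i)).
  case: ifP => [/fX0|/negbT/fY0 //].
  by case: (j : nat).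
have b_mem i j : (i < size s)%N -> (j < nth 0 s i)%N -> c i j \in <<b>>%VS.
  move=> lt_i lt_j; have <- := bE (Ordinal lt_i) (Ordinal lt_j).
  by rewrite memv_span // -tnth_nth mem_tnth.
have im_sub : (limg f <= <<b>>)%VS.
  rewrite -{1}(span_basis (vbasisP (limg f))); apply/span_subvP => v.
  case/(nthP 0) => i; rewrite size_tuple => lt_ir <-.
  have lt_i : (i < size s)%N by rewrite size_s ltn_addr.
  by have := b_mem i 1%N lt_i; rewrite nth_s // /c lt_ir; apply.
have ker_sub : (lker f <= <<b>>)%VS.
  rewrite -(addv_diff_cap (lker f) (limg f)) subv_add.
  rewrite (subv_trans (capvSr _ _)) // andbT -/W.
  rewrite -{1}(span_basis (vbasisP W)); apply/span_subvP => v.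
  case/(nthP 0) => i; rewrite size_tuple => lt_iW <-.
  have lt_i : (r + i < size s)%N by rewrite size_s ltn_add2l.
  have := b_mem (r + i)%N 0%N lt_i; rewrite nth_s // /c.
  by rewrite [(r + i < r)%N]ltnNge leq_addr /= addKn; apply.
rewrite basisEdim; apply/andP; split.
  (* [v] differs from a combination [v'] of the preimages by an element of the
     kernel. *)
  apply/subvP => v _; pose X := vbasis (limg f).
  pose v' := \sum_(i < r) coord X i (f v) *: f^-1%VF X`_i.
  have fv' : f v' = f v.
    have fv_im : f v \in limg f by rewrite memv_img ?memvf.
    rewrite [RHS](coord_vbasis fv_im) linear_sum; apply: eq_bigr.
    by move=> i _; rewrite linearZ /= limg_lfunVK ?Xmem.
  rewrite -(subrK v' v) memvD //.
    by rewrite (subvP ker_sub) // memv_ker linearB /= fv' subrr.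
  apply: memv_suml => i _; rewrite memvZ //.
  have lt_i : (i < size s)%N by rewrite size_s ltn_addr.
  by have := b_mem i 0%N lt_i; rewrite nth_s // /c ltn_ord; apply.
have -> : size b = sumn s by rewrite size_tuple sumnE (big_nth 0%N) big_mkord.
rewrite -dim_g sumn_cat !sumn_nseq; lia.
Qed.
End Jordan.

(** * Central elements and ranks *)

Section LieFacts.
Variables (K : fieldType) (g : lieAlgType K).
Implicit Types (x y z u v w : g) (W : {vspace g}).

Lemma lieC x y : lie y x = - lie x y.
Proof.
apply/eqP; rewrite -addr_eq0.
have := liexx (x + y); rewrite linearDl /= !linearDr /= !liexx addr0 add0r.
by rewrite addrC => ->.
Qed.

Lemma memv_lie x y : lie x y \in lower_central g 1.
Proof. exact: (lie_spanP _ _ _ (subvv _)) (memvf x) (memvf y). Qed.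

Lemma lower_central1_sub W :
  (forall x y, lie x y \in W) -> (lower_central g 1 <= W)%VS.
Proof. by move=> lieW; apply/lie_spanP. Qed.

Lemma adE x y : ad x y = lie x y.
Proof. by rewrite lfunE. Qed.

Lemma lie_ideal_of_derived_sub W : (lower_central g 1 <= W)%VS -> lie_ideal W.
Proof. by move=> /subvP subW x y _; rewrite subW // memv_lie. Qed.

Lemma central_decomposable z :
  lower_central g 1 <> 0%VS ->
  (forall x, lie x z = 0) -> z \notin lower_central g 1 -> decomposable g.
Proof.
set C := lower_central g 1 => C_neq0 z_central zC.
(* A complement of [<z>] that contains [C]. *)
pose J := (C + (C + <[z]>)^C)%VS.
have C_J : (C <= J)%VS by apply: addvSl.
exists <[z]>%VS, J; split; split.
- move=> x _ /vlineP[k ->]; rewrite linearZr_LR /= z_central scaler0.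
  exact: mem0v.
- exact: lie_ideal_of_derived_sub.
- by move/eqP; rewrite -dimv_eq0 dim_vline eqb0 negbK => /eqP z0;
     rewrite z0 mem0v in zC.
- by move=> J0; apply: C_neq0; apply/eqP; rewrite -subv0 -J0.
- by rewrite addvA (addvC _ C) addv_complf.
apply/eqP; rewrite -subv0; apply/subvP => v; rewrite memv_cap memv0.
case/andP => /vlineP[k ->] /memv_addP[c Cc [d Dd kz]].
have d0 : d = 0.
  apply/eqP; rewrite -memv0 -(capv_compl (C + <[z]>)%VS) memv_cap Dd andbT.
  rewrite -(addKr c d) -kz memvD ?memvN ?(subvP (addvSl _ _) _ Cc) //.
  by rewrite (subvP (addvSr _ _)) // memvZ ?memv_line.
rewrite scaler_eq0; case: eqP => //= k_neq0; case/negP: zC.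
by rewrite -(scalerK (introN eqP k_neq0) z) kz d0 addr0 memvZ.
Qed.

Lemma square_ad x : two_step_nilpotent g -> (ad x \o ad x = 0)%VF.
Proof.
case=> C2 _; apply/lfunP => y; rewrite comp_lfunE !adE zero_lfunE.
apply/eqP; rewrite -memv0 -C2.
exact: (lie_spanP _ _ _ (subvv _)) (memvf x) (memv_lie x y).
Qed.

Lemma ad_central x c :
  two_step_nilpotent g -> c \in lower_central g 1 -> lie x c = 0.
Proof.
case=> C2 _ Cc; apply/eqP; rewrite -memv0 -C2.
exact: (lie_spanP _ _ _ (subvv _)) (memvf x) Cc.
Qed.

Lemma characteristic_sequence_rank :
  two_step_nilpotent g -> characteristic_sequence g [:: 2; 2; 1; 1; 1; 1]%N ->
  (exists x, \dim (limg (ad x)) = 2%N) /\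
  (forall x, (\dim (limg (ad x)) <= 2)%N).
Proof.
move=> nil2 [[x _ x_type] max_type].
have rank_le w : (\dim (limg (ad w)) <= 2)%N.
  have [Cw | notCw] := boolP (w \in lower_central g 1).
    suff -> : ad w = 0 by rewrite lim0g dimv0.
    by apply/lfunP => y; rewrite adE zero_lfunE lieC ad_central ?oppr0.
  (* If the rank were at least 3, this type would start with (2, 2, 2) and
     exceed the maximum. *)
  have [m w_type] := square_zero_jordan_type (square_ad w nil2).
  have := max_type _ _ notCw w_type.
  by case: (\dim (limg (ad w))) => [|[|[|r]]].
split=> //; exists x; apply/eqP; rewrite eqn_leq rank_le.
exact: jordan_type22_rank x_type.
Qed.
End LieFacts.

(** * Derived algebra of dimension at most 2 *)

Section Symplectic.
Variables (K : fieldType) (g : lieAlgType K) (theta : {skew_symmetric g}).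
Hypotheses (theta_closed : closed_form theta) (theta_nd : nondegenerate theta).

Lemma skew_nondegenerate u : (forall v, theta u v = 0) -> u = 0.
Proof.
move=> u_orth; apply/eqP; rewrite -memv0 -(eqP theta_nd).
by apply/mem_orthovP => v _; apply: u_orth.
Qed.

(** For [u] in the orthogonal [H] of the derived algebra, being central is the
    vanishing of the three numbers [theta [p, u] p], [theta [p, u] q] and
    [theta [q, u] q], where [p] and [q] span a complement of [H]. *)
Lemma symplectic_central :
  (\dim (lower_central g 1) <= 2)%N -> (7 < \dim {:g})%N ->
  exists2 z, forall x, lie x z = 0 & z \notin lower_central g 1.
Proof.
set C := lower_central g 1 => dimC dim_g.
pose pairing v : 'Hom(g, K^o) := linfun (applyr theta v : g -> K^o).
have pairingE v u : pairing v u = theta u v by rewrite lfunE.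
have thetaN u v : theta u v = 0 -> theta v u = 0.
  by move/eqP; rewrite herm_eq0C => /eqP.
have [a [b Cab]] := span_pair dimC.
pose H := (\bigcap_(phi <- [:: pairing a; pairing b]) lker phi)%VS.
have HC h c : h \in H -> c \in C -> theta c h = 0.
  rewrite /H !big_cons big_nil capvf memv_cap !memv_ker !pairingE.
  move=> /andP[/eqP ha /eqP hb]; rewrite [C]Cab => /mem_span_pair[s [t ->]].
  by apply: thetaN; rewrite linearDr !linearZr_LR /= ha hb !mulr0 addr0.
have Habel h k : h \in H -> k \in H -> lie h k = 0.
  move=> Hh Hk; apply: skew_nondegenerate => v.
  have := theta_closed h k v.
  by rewrite (HC h) ?memv_lie // (HC k) ?memv_lie // !addr0.
have dimHC : (\dim H^C <= 2)%N.
  have := leq_dim_bigcap_lker [:: pairing a; pairing b].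
  by rewrite -/H dimv_compl leq_subLR addnC.
have [p [q HCpq]] := span_pair dimHC.
have decomp v : exists h s t, h \in H /\ v = h + (s *: p + t *: q).
  have := memvf v; rewrite -(addv_complf H) HCpq.
  by case/memv_addP => h Hh [_ /mem_span_pair[s [t ->]] ->]; exists h, s, t.
pose conditions :=
  [:: pairing a; pairing b; (pairing p \o ad p)%VF; (pairing q \o ad p)%VF;
      (pairing q \o ad q)%VF].
have /subvPn[z] : ~~ (\bigcap_(phi <- conditions) lker phi <= C)%VS.
  apply/negP => /dimvS le_dim.
  have := leq_trans dim_g (leq_dim_bigcap_lker conditions).
  by rewrite leqNgt ltnS (leq_add (leq_trans le_dim dimC)).
rewrite /conditions !big_cons big_nil capvf !memv_cap !memv_ker.
rewrite !comp_lfunE !pairingE !adE.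
case/and5P => za zb /eqP zpp /eqP zpq /eqP zqq zC; exists z => //.
have Hz : z \in H.
  by rewrite /H !big_cons big_nil capvf memv_cap !memv_ker !pairingE za.
(* The missing fourth condition follows from closedness at [(p, q, z)]. *)
have zqp : theta (lie q z) p = 0.
  have := theta_closed p q z; rewrite (HC z) ?memv_lie // add0r.
  by rewrite [lie z p]lieC linearNl /= zpq oppr0 addr0.
have lie0 w : theta (lie w z) p = 0 -> theta (lie w z) q = 0 -> lie w z = 0.
  move=> wp wq; apply: skew_nondegenerate => v.
  have [h [s [t [Hh ->]]]] := decomp v.
  rewrite !linearDr !linearZr_LR /= wp wq !mulr0 !addr0.
  by rewrite (HC h) ?memv_lie.
move=> x; have [h [s [t [Hh ->]]]] := decomp x.
rewrite !linearDl !linearZl_LR /= Habel // (lie0 p) // (lie0 q) //.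
by rewrite !scaler0 !addr0.
Qed.
End Symplectic.

(** * Derived algebra of dimension at least 3 *)

Section RankTwo.
Variables (K : numFieldType) (g : lieAlgType K).
Hypothesis ad_rank : forall x : g, (\dim (limg (ad x)) <= 2)%N.

(** The rank 2 of [ad x] is maximal, in particular among the [ad (x + t w)]. *)
Lemma ad_lker_sub (x u w : g) :
  \dim (limg (ad x)) = 2%N -> lie x u = 0 -> lie w u \in limg (ad x).
Proof.
move=> rk_x xu0; rewrite -adE; apply: perturbation_rank; last first.
  by rewrite memv_ker adE xu0.
move=> t; rewrite rk_x (_ : ad x + t *: ad w = ad (x + t *: w)) //.
by apply/lfunP => v; rewrite add_lfunE scale_lfunE !adE linearDl /= linearZl_LR.
Qed.

(** The elements [x], [y] and [z] play symmetric roles: the images of [ad x],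
    [ad y] and [ad z] are the coordinate planes of the basis [a, b, c] of the
    derived algebra, and every element of [g] becomes central after the
    subtraction of a combination of [x], [y] and [z]. *)
Lemma rank_two_central (x : g) :
  \dim (limg (ad x)) = 2%N -> (2 < \dim (lower_central g 1))%N ->
  (6 < \dim {:g})%N ->
  exists2 z, forall w : g, lie w z = 0 & z \notin lower_central g 1.
Proof.
set C := lower_central g 1 => rk_x dimC dim_g.
have [a [b im_x]] : exists a b, limg (ad x) = <<[:: a; b]>>%VS.
  by apply: span_pair; rewrite rk_x.
have [y xy] : exists y, lie x y = a.
  have /memv_imgP[y _ ->] : a \in limg (ad x).
    by rewrite im_x memv_span ?inE ?eqxx.
  by exists y; rewrite adE.
have [z xz] : exists z, lie x z = b.
  have /memv_imgP[z _ ->] : b \in limg (ad x).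
    by rewrite im_x memv_span ?inE ?eqxx ?orbT.
  by exists z; rewrite adE.
pose c := lie y z; pose X := [tuple a; b; c].
have aX : a \in <<X>>%VS by rewrite memv_span ?inE ?eqxx.
have bX : b \in <<X>>%VS by rewrite memv_span ?inE ?eqxx ?orbT.
have cX : c \in <<X>>%VS by rewrite memv_span ?inE ?eqxx ?orbT.
have im_xX v : v \in limg (ad x) -> v \in <<X>>%VS.
  by rewrite im_x => /mem_span_pair[s [t ->]]; rewrite memvD ?memvZ.
have decomp u : exists k s t, lie x k = 0 /\ u = k + (s *: y + t *: z).
  have : lie x u \in limg (ad x) by rewrite -adE memv_img ?memvf.
  rewrite im_x => /mem_span_pair[s [t xu]].
  exists (u - (s *: y + t *: z)), s, t; rewrite subrK; split=> //.
  by rewrite linearBr /= xu linearDr !linearZr_LR /= xy xz subrr.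
have C_sub : (C <= <<X>>)%VS.
  have kX k w : lie x k = 0 -> lie w k \in <<X>>%VS.
    by move=> xk; apply: im_xX; apply: ad_lker_sub.
  apply: lower_central1_sub => u v.
  have [k [s [t [xk ->]]]] := decomp u.
  have [k' [s' [t' [xk' ->]]]] := decomp v.
  rewrite linearDl /= memvD //; first by rewrite lieC memvN kX.
  rewrite linearDr /= memvD //; first exact: kX.
  rewrite linearDl !linearDr /= !linearZl_LR !linearZr_LR /= !liexx.
  rewrite (lieC y z) -/c.
  by rewrite !scaler0 add0r addr0 memvD // !(memvZ, memvN).
have freeX : free X.
  by rewrite /free eqn_leq dim_span /= (leq_trans dimC) // dimvS.
pose i0 : 'I_3 := ord0; pose i1 : 'I_3 := lift ord0 ord0.
pose i2 : 'I_3 := lift ord0 (lift ord0 ord0).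
have coordX (i j : 'I_3) : coord X i X`_j = (j == i)%:R by apply: coord_free.
have coord_a i : coord X i a = (i0 == i)%:R by rewrite -coordX.
have coord_b i : coord X i b = (i1 == i)%:R by rewrite -coordX.
have coord_c i : coord X i c = (i2 == i)%:R by rewrite -coordX.
have coord_x v : v \in limg (ad x) -> coord X i2 v = 0.
  rewrite im_x => /mem_span_pair[s [t ->]].
  by rewrite linearD !linearZ /= coord_a coord_b !mulr0 addr0.
have /andP[_ free_bc] : (a \notin <<[:: b; c]>>%VS) && free [:: b; c].
  by rewrite -free_cons.
have /andP[_ free_ac] : (b \notin <<[:: a; c]>>%VS) && free [:: a; c].
  have /perm_free E : perm_eq [:: a; b; c] [:: b; a; c].
    exact: (permEl (perm_catCA [:: a] [:: b] [:: c])).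
  by rewrite -free_cons -E.
(* The image of [ad y] contains [- a = [y, x]] and [c], and its rank is at
   most 2; likewise for [ad z] with [- b] and [- c]. *)
have im_y : limg (ad y) = <<[:: a; c]>>%VS.
  apply/esym/eqP; rewrite eqEdim; apply/andP; split.
    apply/span_subvP => v; rewrite !inE => /orP[] /eqP ->.
      by rewrite -memvN -xy -lieC -adE memv_img ?memvf.
    by rewrite /c -adE memv_img ?memvf.
  by rewrite (eqnP free_ac).
have im_z : limg (ad z) = <<[:: b; c]>>%VS.
  apply/esym/eqP; rewrite eqEdim; apply/andP; split.
    apply/span_subvP => v; rewrite !inE => /orP[] /eqP ->.
      by rewrite -memvN -xz -lieC -adE memv_img ?memvf.
    by rewrite -memvN -lieC -adE memv_img ?memvf.
  by rewrite (eqnP free_bc).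
have coord_y v : v \in limg (ad y) -> coord X i1 v = 0.
  rewrite im_y => /mem_span_pair[s [t ->]].
  by rewrite linearD !linearZ /= coord_a coord_c !mulr0 addr0.
have coord_z v : v \in limg (ad z) -> coord X i0 v = 0.
  rewrite im_z => /mem_span_pair[s [t ->]].
  by rewrite linearD !linearZ /= coord_b coord_c !mulr0 addr0.
have rk_y : \dim (limg (ad y)) = 2%N.
  by rewrite im_y (eqnP free_ac).
have coord_xy v :
    v \in limg (ad x) -> v \in limg (ad y) -> v = coord X i0 v *: a.
  move=> v_x v_y; rewrite {1}(coord_span (im_xX v v_x)) !big_ord_recl big_ord0.
  rewrite (coord_y v v_y) (coord_x v v_x).
  by rewrite !scale0r !addr0.
have decomp3 u :
    exists v, (forall w, lie w v = 0) /\ u - v \in <<[:: x; y; z]>>%VS.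
  have [k [s [t [xk ->]]]] := decomp u.
  (* [k] commutes with [x], so [y, k] lies in both planes [<a, b>] and
     [<a, c>], that is on the line of [a = - [y, x]]: adding a multiple of [x]
     makes it commute with [y] too. *)
  have [l yk] : exists l, lie y k = l *: a.
    exists (coord X i0 (lie y k)); apply: coord_xy; first exact: ad_lker_sub.
    by rewrite -adE memv_img ?memvf.
  pose v := k + l *: x.
  have xv : lie x v = 0.
    by rewrite linearDr linearZr_LR /= xk liexx scaler0 addr0.
  have yv : lie y v = 0.
    by rewrite linearDr linearZr_LR /= yk (lieC x y) xy scalerN subrr.
  (* For the same reason all brackets with [v] are multiples of [a]; the one
     with [z] also lies in [<b, c>], so it is 0. *)
  have wvE w : lie w v = coord X i0 (lie w v) *: a.
    by apply: coord_xy; apply: ad_lker_sub.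
  have zv : lie z v = 0.
    by rewrite wvE coord_z ?scale0r // -adE memv_img ?memvf.
  (* Now the third plane [<b, c>] is available for every bracket with [v]. *)
  exists v; split.
    move=> w; rewrite wvE coord_z ?scale0r //; apply: ad_lker_sub => //.
    by rewrite im_z (eqnP free_bc).
  have -> : k + (s *: y + t *: z) - v = - l *: x + (s *: y + t *: z).
    by rewrite /v opprD addrACA subrr add0r scaleNr addrC.
  by rewrite !memvD ?memvZ // memv_span ?inE ?eqxx ?orbT.
have /subvPn[u _ uC] : ~~ (fullv <= <<[:: x; y; z]>> + C)%VS.
  apply/negP => /dimvS; apply/negP; rewrite -ltnNge.
  apply: leq_ltn_trans dim_g; apply: (leq_trans (dimv_add_leqif _ _)).
  by rewrite (leq_add (dim_span _) (leq_trans (dimvS C_sub) (dim_span _))).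
have [v [v_central uv]] := decomp3 u; exists v => //.
by apply: contra uC => vC; rewrite -(subrK v u) memv_add.
Qed.
End RankTwo.

(** * Symplectic algebras of characteristic sequence (2, 2, 1, 1, 1, 1) *)

Theorem symplectic_decomposable (K : numFieldType) (g : lieAlgType K) :
  \dim {:g} = 8%N -> two_step_nilpotent g -> symplectic g ->
  characteristic_sequence g [:: 2; 2; 1; 1; 1; 1]%N -> decomposable g.
Proof.
move=> dim_g nil2 [_ [theta [theta_closed theta_nd]]] char_g.
have [[x rk_x] ad_rank] := characteristic_sequence_rank nil2 char_g.
suff [z z_central zC] :
    exists2 z : g, forall w, lie w z = 0 & z \notin lower_central g 1.
  by apply: central_decomposable z_central zC; case: nil2.
have [dimC | dimC] := leqP (\dim (lower_central g 1)) 2.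
  by apply: (symplectic_central theta_closed theta_nd dimC); rewrite dim_g.
by apply: rank_two_central rk_x dimC _ => //; rewrite dim_g.
Qed.

Theorem theorem22 (R : realType) :
  (forall g : lieAlgType R,
     \dim {:g} = 8%N -> two_step_nilpotent g -> symplectic g ->
     characteristic_sequence g [:: 2; 2; 1; 1; 1; 1]%N -> decomposable g)
  /\
  (forall g : lieAlgType R[i],
     \dim {:g} = 8%N -> two_step_nilpotent g -> symplectic g ->
     characteristic_sequence g [:: 2; 2; 1; 1; 1; 1]%N -> decomposable g).
Proof. by split=> g; apply: symplectic_decomposable. Qed.
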